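(* Consider the restricted system of two bouncing balls in which $P_1$ has zero mass, $P_2$ has non-zero mass, and $P_2$ is situated between the plate $z=f(t)$ and the ball $P_1$. If $f$ is a periodic function of class $C^1$, then it is impossible that $P_2$ has unbounded velocity while $P_1$ has bounded velocity. If $f\in\mathcal{C}$, then there are initial conditions for which both balls have unbounded velocity.
   Context: Restricted system of two bouncing balls: two elastic point particles $P_1,P_2$ move on a vertical line (coordinate $z$) in a gravitational field with constant acceleration $g>0$ (so $\ddot z=-g$ for each ball between collisions), above an infinitely heavy horizontal plate which oscillates according to $z=f(t)$, where $f$ has period $T>0$. The mass of $P_1$ is zero and that of $P_2$ is non-zero. Here the lower ball is $P_2$ and the upper ball is $P_1$. At a collision of $P_2$ with the plate at time $s$, its velocity $v^-$ becomes $v^+=-v^-+2\dot f(s)$. The two balls interact according to the law of elastic collisions, and $P_1$ does not influence $P_2$ since it has zero mass: at a collision between the balls the velocity $v^{(2)}$ of $P_2$ is unchanged and the velocity $v^{(1)}_-$ of $P_1$ becomes $v^{(1)}_+=-v^{(1)}_-+2v^{(2)}$. A ball has bounded velocity along an orbit if the absolute value of its velocity $v(\tau)$ satisfies $\sup_\tau|v(\tau)|<\infty$; otherwise it has unbounded velocity. Class $\mathcal{C}$: $\mathcal{C}:=\{f: f \text{ is periodic with period } T \text{ and there exists } t_0 \text{ with } \dot f(t_0)=KTg/2 \text{ for some positive integer } K\}$. *)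

(* Defs.v *)
(* Stdlib reals with Coquelicot. *)
From Stdlib Require Export Reals List.
From Coquelicot Require Export Coquelicot.
Open Scope R_scope.

Definition periodic (T : R) (f : R -> R) : Prop := forall t, f (t + T) = f t.

Definition class_C1 (f : R -> R) : Prop :=
  (forall t, ex_derive f t) /\ (forall t, continuous (Derive f) t).

(* Differentiability is the least regularity under which the collision law at
   the plate, which involves the velocity of the plate, makes sense; continuity
   of the derivative is not required. *)
Definition class_C (g T : R) (f : R -> R) : Prop :=
  periodic T f /\
  (forall t, ex_derive f t) /\
  exists (t0 : R) (K : nat), (0 < K)%nat /\ Derive f t0 = INR K * T * g / 2.

(* Free flight at the instant t, i.e. z' = v and v' = - g. *)
Definition free_at (g : R) (z v : R -> R) (t : R) : Prop :=
  is_derive z t (v t) /\ is_derive v t (- g).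

(* Throughout, v t is the velocity just after the instant t: at a collision it
   is the post-collision velocity v^+, and v^- is the limit of v from the left. *)
Definition velocity_before (v : R -> R) (s vm : R) : Prop :=
  filterlim v (at_left s) (locally vm).

(* Elastic reflection from an infinitely heavier obstacle moving at velocity u. *)
Definition elastic_reflection (v : R -> R) (s u : R) : Prop :=
  exists vm, velocity_before v s vm /\ v s = - vm + 2 * u.

(* Position z and velocity v of one ball on the time interval [t0, +oo).  The
   last field says that the interruptions of the free flight do not accumulate,
   which excludes infinitely many collisions in finite time and a ball resting
   on its obstacle. *)
Record ball_motion (g t0 : R) (z v : R -> R) : Prop := {
  motion_start : filterlim z (at_right t0) (locally (z t0));
  motion_continuous : forall t, t0 < t -> continuous z t;
  motion_velocity : forall t, t0 <= t -> filterlim v (at_right t) (locally (v t));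
  motion_discrete : forall b, exists l : list R,
    forall t, t0 < t <= b -> ~ free_at g z v t -> In t l
}.

(* Forward orbit of the restricted system over the plate z = f(t).  The values
   at t0 are the initial condition, and they determine the orbit.  The massless
   ball P1 = (z1, v1) is above P2 = (z2, v2); P1 does not act on P2, and P2 acts
   on P1 as an infinitely heavy obstacle.  The collision laws leave simultaneous
   contact of the plate and both balls undefined; orbit_no_triple excludes it.
   So at a collision of the balls P2 is in free flight, v2 is continuous there,
   and v2 s is the velocity of P2 both before and after the collision. *)
Record restricted_orbit (g : R) (f : R -> R) (t0 : R)
    (z1 v1 z2 v2 : R -> R) : Prop := {
  orbit_motion1 : ball_motion g t0 z1 v1;
  orbit_motion2 : ball_motion g t0 z2 v2;
  orbit_order : forall t, t0 <= t -> f t <= z2 t <= z1 t;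
  orbit_no_triple : forall t, t0 <= t -> f t < z1 t;
  orbit_free2 : forall t, t0 < t -> f t < z2 t -> free_at g z2 v2 t;
  orbit_plate : forall s, t0 < s -> z2 s = f s ->
    elastic_reflection v2 s (Derive f s);
  orbit_free1 : forall t, t0 < t -> z2 t < z1 t -> free_at g z1 v1 t;
  orbit_balls : forall s, t0 < s -> z1 s = z2 s ->
    elastic_reflection v1 s (v2 s)
}.

(* Pre-collision velocities are limits of values of v, so bounding v bounds
   them as well. *)
Definition bounded_velocity (t0 : R) (v : R -> R) : Prop :=
  exists M, forall t, t0 <= t -> Rabs (v t) <= M.

Definition unbounded_velocity (t0 : R) (v : R -> R) : Prop :=
  ~ bounded_velocity t0 v.

(* Main.v *)
Require Import Defs.
From Stdlib Require Import Lra Lia ZArith Classical IndefiniteDescription.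

(** Impossibility.  The collision law makes the velocity of the lower ball at a
    meeting the mean of the velocities of the upper ball before and after it.  If
    the upper ball has speed at most [M], the lower one therefore has speed at
    most [M] at every meeting ([collision_speed]).  On the other hand the upper
    ball loses velocity at rate [g] in free flight, so it must meet the lower
    ball again within a time [2 * M / g] ([fast_interval_short]).  Now suppose
    that the lower ball is very fast at some instant.  The velocity of the plate
    is continuous and periodic, hence bounded, so the plate can neither catch a
    ball that rises much faster than it ([ascent_without_contact]) nor have sent
    off recently a ball that falls much faster ([descent_without_contact]).  The
    lower ball is therefore in free flight, and remains faster than [M], on an
    interval longer than [2 * M / g] lying after, respectively before, that
    instant; this contradicts the two facts above.

    Existence.  Let the plate have velocity [g * r / 2] at time [t0], where
    [r = K * T].  Throw the lower ball from the plate at [t0] so that its flight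
    takes a multiple of [T].  Then it returns at the same phase and height and
    each bounce lengthens the flight by [2 * r], again a multiple of [T]; so the
    ball meets the plate always at the same phase, with flight times
    [len n = len 0 + 2 * r * n], and its velocity grows without bound.  It stays
    above the plate between bounces because long flights leave and arrive
    steeply, while [f] is at most linearly far from its value at [t0]
    ([growth_from_point]).

    Not every start of the upper ball is safe: it might later hit the lower ball
    exactly when that ball is on the plate.  The choice below is explicit.  The
    upper ball is at rest at each bounce time [tau n] of the lower ball, at height
    [g / 4 * len n * len (n - 1)] above the bounce point, where [len (n - 1)] means
    [len n - 2 * r] also for [n = 0].  The relative motion
    of the balls in free flight is uniform, and one finds a single meeting during
    the [n]-th flight, at time [len (n - 1) / 2] after [tau n], where the lower
    ball has velocity [g * r].  The reflected upper ball then reaches its apex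
    precisely at [tau (S n)], so the pattern repeats.  Both orbits are thus given
    as chains of parabolic arcs, and the laws of motion reduce to polynomial
    identities ([resonant_orbit]). *)

(** * One-sided limits and zeros of continuous functions *)

Lemma locally_between (P : R -> Prop) (a x b : R) :
  a < x < b -> (forall y, a < y < b -> P y) -> locally x P.
Proof.
  intros Hx HP. apply (locally_interval P x a b); simpl; try tauto.
  intros y H1 H2; apply HP; split; assumption.
Qed.

Lemma at_right_between (P : R -> Prop) (a b : R) :
  a < b -> (forall y, a < y < b -> P y) -> at_right a P.
Proof.
  intros Hab HP. apply (locally_between _ (a - 1) a b); [lra|].
  intros y Hy Hay; apply HP; lra.
Qed.

Lemma at_left_between (P : R -> Prop) (a b : R) :
  a < b -> (forall y, a < y < b -> P y) -> at_left b P.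
Proof.
  intros Hab HP. apply (locally_between _ a b (b + 1)); [lra|].
  intros y Hy Hyb; apply HP; lra.
Qed.

Lemma limit_agree (F : (R -> Prop) -> Prop) (FF : ProperFilter F)
    (h k : R -> R) (x l : R) :
  filter_le F (locally x) -> F (fun y => h y = k y) ->
  filterlim h F (locally l) -> continuous k x -> l = k x.
Proof.
  intros HF Heq Hh Hk.
  apply (filterlim_locally_unique (F := F) h); [assumption|].
  apply (filterlim_ext_loc k h).
  - apply filter_imp with (2 := Heq); intros y Hy; now symmetry.
  - exact (filterlim_filter_le_1 _ HF Hk).
Qed.

Lemma right_limit_agree (h k : R -> R) (a b l : R) :
  a < b -> (forall y, a < y < b -> h y = k y) ->
  filterlim h (at_right a) (locally l) -> continuous k a -> l = k a.
Proof.
  intros Hab Heq. apply (limit_agree (at_right a) (at_right_proper_filter a)).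
  - apply (filter_le_within (F := locally _)).
  - now apply (at_right_between _ a b).
Qed.

Lemma left_limit_agree (h k : R -> R) (a b l : R) :
  a < b -> (forall y, a < y < b -> h y = k y) ->
  filterlim h (at_left b) (locally l) -> continuous k b -> l = k b.
Proof.
  intros Hab Heq. apply (limit_agree (at_left b) (at_left_proper_filter b)).
  - apply (filter_le_within (F := locally _)).
  - now apply (at_left_between _ a b).
Qed.

Lemma derivable_is_continuous (k : R -> R) (x l : R) : is_derive k x l -> continuous k x.
Proof.
  intros H. apply (ex_derive_continuous (V := R_NormedModule)). now exists l.
Qed.

Lemma first_zero (h : R -> R) (a b : R) :
  (forall t, a <= t <= b -> continuous h t) -> h a <> 0 -> a <= b -> h b = 0 ->
  exists s, a < s <= b /\ h s = 0 /\ forall t, a <= t < s -> h t <> 0.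
Proof.
  intros Hc Ha Hab Hb.
  pose (E := fun x => a <= x <= b /\ forall t, a <= t <= x -> h t <> 0).
  assert (Ea : E a).
  { split; [lra|]. intros t Ht. replace t with a by lra. exact Ha. }
  destruct (completeness E) as [s [Hub Hlub]].
  { exists b. intros x [Hx _]; lra. }
  { now exists a. }
  assert (Has : a <= s) by now apply Hub.
  assert (Hsb : s <= b) by (apply Hlub; intros x [Hx _]; lra).
  assert (Hbefore : forall t, a <= t < s -> h t <> 0).
  { intros t Ht H0. assert (s <= t); [|lra].
    apply Hlub. intros x [Hx HE]. apply Rnot_lt_le; intros Htx.
    apply (HE t); [lra|exact H0]. }
  assert (Hs : h s = 0).
  { apply NNPP; intros Hs.
    assert (Hpos : 0 < Rabs (h s)) by now apply Rabs_pos_lt.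
    pose proof (Hc s (conj Has Hsb)) as Hcs.
    apply filterlim_locally with (eps := mkposreal _ Hpos) in Hcs.
    destruct Hcs as [d Hd].
    assert (Hnear : forall t, s <= t < s + d -> h t <> 0).
    { intros t Ht H0.
      assert (Hball : ball s d t).
      { change (Rabs (t - s) < d). rewrite Rabs_pos_eq; lra. }
      specialize (Hd t Hball). change (Rabs (h t - h s) < Rabs (h s)) in Hd.
      rewrite H0, Rminus_0_l, Rabs_Ropp in Hd. lra. }
    pose proof (cond_pos d) as Hdp.
    pose (x := Rmin b (s + d / 2)).
    assert (Hx : x <= b /\ x <= s + d / 2) by (split; [apply Rmin_l|apply Rmin_r]).
    assert (Hsx : s <= x) by (apply Rmin_glb; lra).
    assert (Ex : E x).
    { split; [lra|]. intros t Ht.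
      destruct (Rlt_dec t s); [apply Hbefore|apply Hnear]; lra. }
    assert (x <= s) by now apply Hub.
    apply (Hnear b); [|exact Hb].
    unfold x in *. revert H Hx. unfold Rmin; destruct (Rle_dec b (s + d / 2)); lra. }
  exists s. split; [|split; assumption].
  split; [|exact Hsb]. destruct Has as [Has|Has]; [exact Has|].
  exfalso; apply Ha. now rewrite Has.
Qed.

Lemma last_zero (h : R -> R) (a b : R) :
  (forall t, a <= t <= b -> continuous h t) -> h b <> 0 -> a <= b -> h a = 0 ->
  exists s, a <= s < b /\ h s = 0 /\ forall t, s < t <= b -> h t <> 0.
Proof.
  intros Hc Hb Hab Ha.
  destruct (first_zero (fun x => h (- x)) (- b) (- a)) as [s [Hs [H0 Hn]]].
  - intros t Ht. apply (continuous_comp (fun x : R => - x) h).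
    + apply (continuous_opp (V := R_NormedModule) (fun x : R => x)). apply continuous_id.
    + apply Hc; lra.
  - now rewrite Ropp_involutive.
  - lra.
  - now rewrite Ropp_involutive.
  - exists (- s). split; [lra|]. split; [exact H0|].
    intros t Ht. rewrite <- (Ropp_involutive t). apply Hn; lra.
Qed.

(** * Periodic functions *)

Lemma periodic_shift (T : R) (u : R -> R) :
  periodic T u -> forall n x, u (x + INR n * T) = u x.
Proof.
  intros Hu n x. induction n as [|n IH].
  - simpl. f_equal; ring.
  - rewrite S_INR, <- IH, <- (Hu (x + INR n * T)). f_equal; ring.
Qed.

Lemma periodic_bounded (T : R) (u : R -> R) :
  0 < T -> periodic T u -> (forall t, continuous u t) ->
  exists M, forall t, Rabs (u t) <= M.
Proof.
  intros HT Hu Hc.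
  destruct (continuity_ab_maj (fun t => Rabs (u t)) 0 T) as [m [Hm _]].
  - lra.
  - intros c _. apply continuity_pt_filterlim.
    apply (continuous_comp u Rabs); [apply Hc|apply continuous_Rabs].
  - exists (Rabs (u m)). intros t.
    destruct (base_Int_part (t / T)) as [H1 H2].
    set (k := Int_part (t / T)) in *.
    assert (Et : t = t / T * T) by (field; lra).
    assert (Hr : 0 <= t - IZR k * T <= T) by (rewrite Et at 1 2; nra).
    replace (u t) with (u (t - IZR k * T)); [now apply Hm|].
    destruct (Z_le_gt_dec 0 k) as [Hk|Hk].
    + rewrite <- (periodic_shift T u Hu (Z.to_nat k)).
      f_equal. rewrite INR_IZR_INZ, Z2Nat.id by lia. ring.
    + rewrite <- (periodic_shift T u Hu (Z.to_nat (- k)) t).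
      f_equal. rewrite INR_IZR_INZ, Z2Nat.id, opp_IZR by lia. ring.
Qed.

Lemma Derive_periodic (T : R) (f : R -> R) :
  periodic T f -> periodic T (Derive f).
Proof.
  intros Hf t. unfold Derive. f_equal. apply Lim_ext. intros h.
  now replace (t + T + h) with (t + h + T) by ring; rewrite !Hf.
Qed.

Lemma periodic_C1_lipschitz (T : R) (f : R -> R) :
  0 < T -> periodic T f -> class_C1 f ->
  exists L, forall x y, Rabs (f y - f x) <= L * Rabs (y - x).
Proof.
  intros HT Hf [Hd Hc].
  destruct (periodic_bounded T (Derive f) HT (Derive_periodic T f Hf) Hc) as [L HL].
  exists L. intros x y. apply bounded_variation with (dh := Derive f).
  intros t _. split; [apply Derive_correct, Hd|apply HL].
Qed.

(** * Free flight *)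

Definition arc (g a h t : R) : R := h - g / 2 * (t - a) ^ 2.

Lemma is_derive_arc (g a h t : R) : is_derive (arc g a h) t (- g * (t - a)).
Proof. unfold arc. auto_derive; [exact I|field]. Qed.

Lemma constant_from_right (k : R -> R) (a b : R) :
  (forall t, a < t < b -> is_derive k t 0) ->
  filterlim k (at_right a) (locally (k a)) ->
  forall t, a < t < b -> k t = k a.
Proof.
  intros Hd Hl t Ht.
  symmetry.
  apply (right_limit_agree k (fun _ => k t) a t);
    [lra| |exact Hl|apply continuous_const].
  intros y Hy. apply (eq_is_derive k); [|lra]. intros s Hs. apply Hd; lra.
Qed.

Lemma free_flight (g : R) (z v : R -> R) (a b : R) :
  (forall t, a < t < b -> free_at g z v t) ->
  filterlim z (at_right a) (locally (z a)) ->
  filterlim v (at_right a) (locally (v a)) ->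
  forall t, a < t < b ->
    v t = v a - g * (t - a) /\ z t = z a + v a * (t - a) - g / 2 * (t - a) ^ 2.
Proof.
  intros Hfree Hz Hv.
  assert (Hright : forall k p : R -> R, filterlim k (at_right a) (locally (k a)) ->
            continuous p a ->
            filterlim (fun t => k t + p t) (at_right a) (locally (k a + p a))).
  { intros k p Hk Hp.
    apply (filterlim_comp_2 (G := locally (k a)) (H := locally (p a))); [exact Hk| |].
    - apply (filterlim_filter_le_1 _ (filter_le_within (F := locally a) _) Hp).
    - apply (filterlim_plus (V := R_NormedModule)). }
  assert (Hvt : forall t, a < t < b -> v t = v a - g * (t - a)).
  { intros t Ht.
    pose proof (constant_from_right (fun t => v t + g * (t - a)) a b) as Hk.
    cbv beta in Hk. rewrite <- (Rplus_0_r (v a)), <- (Rmult_0_r g).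
    replace 0 with (a - a) at 1 by ring.
    rewrite <- (Hk) with (t := t); [ring| | |exact Ht].
    - intros s Hs. destruct (Hfree s Hs) as [_ Hs'].
      replace 0 with (- g + g) by ring.
      apply (is_derive_plus v (fun t => g * (t - a))); [exact Hs'|].
      auto_derive; [exact I|ring].
    - apply (Hright v (fun t => g * (t - a)) Hv).
      apply derivable_is_continuous with (l := g). auto_derive; [exact I|ring]. }
  intros t Ht. split; [now apply Hvt|].
  pose proof (constant_from_right
    (fun t => z t + (g / 2 * (t - a) ^ 2 - v a * (t - a))) a b) as Hk.
  cbv beta in Hk. cut (z t + (g / 2 * (t - a) ^ 2 - v a * (t - a)) = z a); [lra|].
  rewrite Hk; [ring| | |exact Ht].
  - intros s Hs. destruct (Hfree s Hs) as [Hs' _].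
    replace 0 with (v s + (g * (s - a) - v a)) by (rewrite Hvt by assumption; ring).
    apply (is_derive_plus z (fun t => g / 2 * (t - a) ^ 2 - v a * (t - a))); [exact Hs'|].
    auto_derive; [exact I|field].
  - apply (Hright z (fun t => g / 2 * (t - a) ^ 2 - v a * (t - a)) Hz).
    apply derivable_is_continuous with (l := - v a). auto_derive; [exact I|ring].
Qed.

Lemma list_gap (l : list R) (t : R) :
  exists d, 0 < d /\ forall x, In x l -> t < x -> t + d <= x.
Proof.
  induction l as [|y l [d [Hd Hl]]].
  - exists 1. split; [lra|]. intros x [].
  - destruct (Rlt_dec t y) as [Hy|Hy].
    + exists (Rmin d (y - t)). split; [apply Rmin_glb_lt; lra|].
      pose proof (Rmin_l d (y - t)). pose proof (Rmin_r d (y - t)).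
      intros x [<-|Hx] Htx; [lra|]. specialize (Hl x Hx Htx). lra.
    + exists d. split; [exact Hd|]. intros x [<-|Hx] Htx; [lra|auto].
Qed.

(** Interruptions of the free flight are finite in number up to any given time, so
    each instant, even that of a collision, is followed by some free flight. *)
Lemma free_after (g t0 : R) (z v : R -> R) :
  ball_motion g t0 z v -> forall t, t0 <= t ->
  exists d, 0 < d /\ forall s, t < s < t + d -> free_at g z v s.
Proof.
  intros Hm t Ht.
  destruct (motion_discrete _ _ _ _ Hm (t + 1)) as [l Hl].
  destruct (list_gap l t) as [d [Hd Hgap]].
  exists (Rmin d 1). split; [apply Rmin_glb_lt; lra|].
  pose proof (Rmin_l d 1). pose proof (Rmin_r d 1).
  intros s Hs. apply NNPP; intros Hn.
  assert (t + d <= s) by (apply Hgap; [apply Hl; [lra|exact Hn]|lra]). lra.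
Qed.

Lemma position_right (g t0 : R) (z v : R -> R) :
  ball_motion g t0 z v -> forall t, t0 <= t ->
  filterlim z (at_right t) (locally (z t)).
Proof.
  intros Hm t [Ht|<-]; [|exact (motion_start _ _ _ _ Hm)].
  apply (filterlim_filter_le_1 _ (filter_le_within (F := locally t) _)).
  now apply (motion_continuous _ _ _ _ Hm).
Qed.

Lemma flight_after (g t0 : R) (z v : R -> R) (a b : R) :
  ball_motion g t0 z v -> t0 <= a -> (forall t, a < t < b -> free_at g z v t) ->
  forall t, a < t < b ->
    v t = v a - g * (t - a) /\ z t = z a + v a * (t - a) - g / 2 * (t - a) ^ 2.
Proof.
  intros Hm Ha Hfree. apply free_flight; [exact Hfree| |].
  - now apply (position_right g t0 z v).
  - now apply (motion_velocity _ _ _ _ Hm).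
Qed.

(** Right limits give the velocity only before the end of the flight; freeness at
    [t] itself makes [v] continuous there and so excludes a jump at [t]. *)
Lemma velocity_through_flight (g t0 : R) (z v : R -> R) (a t : R) :
  ball_motion g t0 z v -> t0 <= a -> a < t ->
  (forall s, a < s <= t -> free_at g z v s) -> v t = v a - g * (t - a).
Proof.
  intros Hm Ha Hat Hfree.
  apply (left_limit_agree v (fun s => v a - g * (s - a)) a t); [exact Hat| | |].
  - intros s Hs. apply (flight_after g t0 z v a t Hm Ha); [|exact Hs].
    intros y Hy. apply Hfree; lra.
  - apply (filterlim_filter_le_1 _ (filter_le_within (F := locally t) _)).
    apply derivable_is_continuous with (l := - g). apply Hfree; lra.
  - apply derivable_is_continuous with (l := - g). auto_derive; [exact I|ring].
Qed.

(** * A bounded upper ball forces a bounded lower ball *)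

(** The collision law [v1 s = - vm + 2 * v2 s] makes [v2 s] the mean of the two
    velocities of the upper ball, so a bound for [v1] is a bound for [v2] at
    every meeting. *)
Lemma collision_speed (g : R) (f : R -> R) (t0 : R) (z1 v1 z2 v2 : R -> R) (M : R) :
  restricted_orbit g f t0 z1 v1 z2 v2 ->
  (forall t, t0 <= t -> Rabs (v1 t) <= M) ->
  forall s, t0 < s -> z1 s = z2 s -> Rabs (v2 s) <= M.
Proof.
  intros Ho HM s Hs Hz.
  destruct (orbit_balls _ _ _ _ _ _ _ Ho s Hs Hz) as [vm [Hvm Hv]].
  assert (Hm : Rabs vm <= M).
  { apply (closed_filterlim_loc (F := at_left s) v1 (fun y => Rabs y <= M)).
    - exact Hvm.
    - apply (at_left_between _ t0 s Hs). intros y Hy. apply HM; lra.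
    - apply (closed_comp Rabs (fun y => y <= M)).
      + intros x. apply continuous_Rabs.
      + apply closed_le. }
  specialize (HM s (Rlt_le _ _ Hs)).
  revert Hm HM. rewrite Hv. unfold Rabs; repeat destruct Rcase_abs; lra.
Qed.

(** While the lower ball is faster than [M] the balls cannot meet, so the upper one
    is in free flight and its velocity, confined to [[-M, M]], drops at rate [g]. *)
Lemma fast_interval_short (g : R) (f : R -> R) (t0 : R) (z1 v1 z2 v2 : R -> R) (M : R) :
  restricted_orbit g f t0 z1 v1 z2 v2 ->
  (forall t, t0 <= t -> Rabs (v1 t) <= M) ->
  forall a b, t0 <= a -> (forall t, a < t < b -> M < Rabs (v2 t)) ->
  forall t, a < t < b -> g * (t - a) <= 2 * M.
Proof.
  intros Ho HM a b Ha Hfast t Ht.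
  destruct (flight_after g t0 z1 v1 a b (orbit_motion1 _ _ _ _ _ _ _ Ho) Ha) with (t := t)
    as [Hv _]; [|exact Ht|].
  - intros s Hs. apply (orbit_free1 _ _ _ _ _ _ _ Ho); [lra|].
    destruct (orbit_order _ _ _ _ _ _ _ Ho s) as [_ [Hlt|Heq]]; [lra|exact Hlt|].
    exfalso. specialize (Hfast s Hs).
    assert (Rabs (v2 s) <= M); [|lra].
    apply (collision_speed g f t0 z1 v1 z2 v2 M Ho HM); lra.
  - pose proof (HM a Ha) as Ma. pose proof (HM t ltac:(lra)) as Mt.
    revert Ma Mt. rewrite Hv. unfold Rabs; repeat destruct Rcase_abs; lra.
Qed.

(** Just after a contact the lower ball must not fall into the plate, whose
    velocity is at least [- L]. *)
Lemma contact_velocity (g : R) (f : R -> R) (t0 : R) (z1 v1 z2 v2 : R -> R) (L : R) :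
  0 < g -> (forall x y, Rabs (f y - f x) <= L * Rabs (y - x)) ->
  restricted_orbit g f t0 z1 v1 z2 v2 ->
  forall s, t0 <= s -> z2 s = f s -> - L <= v2 s.
Proof.
  intros Hg HL Ho s Hs Hz.
  pose proof (orbit_motion2 _ _ _ _ _ _ _ Ho) as Hm.
  destruct (free_after g t0 z2 v2 Hm s Hs) as [d [Hd Hfree]].
  pose proof (flight_after g t0 z2 v2 s (s + d) Hm Hs Hfree (s + d / 2)) as Hf.
  destruct Hf as [_ Hf]; [lra|].
  destruct (orbit_order _ _ _ _ _ _ _ Ho (s + d / 2)) as [Hof _]; [lra|].
  specialize (HL s (s + d / 2)). replace (s + d / 2 - s) with (d / 2) in * by ring.
  rewrite (Rabs_pos_eq (d / 2)) in HL by lra.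
  apply Rabs_le_between in HL. nra.
Qed.

Lemma clearance_continuous (g : R) (f : R -> R) (t0 : R) (z1 v1 z2 v2 : R -> R) :
  (forall t, continuous f t) -> restricted_orbit g f t0 z1 v1 z2 v2 ->
  forall t, t0 < t -> continuous (fun t => z2 t - f t) t.
Proof.
  intros Hf Ho t Ht. apply (continuous_minus (V := R_NormedModule) z2 f); [|apply Hf].
  apply (motion_continuous _ _ _ _ (orbit_motion2 _ _ _ _ _ _ _ Ho)); exact Ht.
Qed.

(** Until it has lost the velocity [g * D] the ball stays faster than the plate.
    The order relation alone does not say that [z2] leaves [f] when [t] is itself
    a contact, so the first contact is sought from an instant [t + e] inside the
    free flight that follows [t]. *)
Lemma ascent_without_contact (g : R) (f : R -> R) (t0 : R) (z1 v1 z2 v2 : R -> R) (L D : R) :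
  0 < g -> (forall x y, Rabs (f y - f x) <= L * Rabs (y - x)) ->
  (forall t, continuous f t) ->
  restricted_orbit g f t0 z1 v1 z2 v2 ->
  forall t, t0 <= t -> L + g * D < v2 t ->
  forall s, t < s < t + D -> f s < z2 s.
Proof.
  intros Hg HL Hc Ho t Ht Hv.
  pose proof (orbit_motion2 _ _ _ _ _ _ _ Ho) as Hm.
  destruct (orbit_order _ _ _ _ _ _ _ Ho t Ht) as [Hft _].
  assert (Habove : forall s, t < s < t + D ->
            z2 s = z2 t + v2 t * (s - t) - g / 2 * (s - t) ^ 2 -> f s < z2 s).
  { intros s Hs Hz. specialize (HL t s). rewrite (Rabs_pos_eq (s - t)) in HL by lra.
    apply Rabs_le_between in HL. rewrite Hz.
    assert (0 < (s - t) * (v2 t - L - g / 2 * (s - t))); [|nra].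
    apply Rmult_lt_0_compat; nra. }
  intros s Hs. destruct (orbit_order _ _ _ _ _ _ _ Ho s) as [[Hlt|Heq] _]; [lra|exact Hlt|].
  exfalso.
  destruct (free_after g t0 z2 v2 Hm t Ht) as [d [Hd Hfree]].
  pose (e := Rmin (d / 2) ((s - t) / 2)).
  assert (He : 0 < e) by (apply Rmin_glb_lt; lra).
  assert (Hed : e <= d / 2) by apply Rmin_l.
  assert (Hes : e <= (s - t) / 2) by apply Rmin_r.
  assert (Hfirst : forall x, t < x <= t + e -> f x < z2 x).
  { intros x Hx. apply Habove; [lra|].
    apply (flight_after g t0 z2 v2 t (t + d) Hm Ht Hfree). lra. }
  destruct (first_zero (fun x => z2 x - f x) (t + e) s) as [c [Hcs [Hc0 Hcn]]].
  - intros x Hx. apply (clearance_continuous g f t0 z1 v1 z2 v2 Hc Ho). lra.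
  - specialize (Hfirst (t + e)). lra.
  - lra.
  - lra.
  - assert (Hgap : forall x, t < x < c -> free_at g z2 v2 x).
    { intros x Hx. apply (orbit_free2 _ _ _ _ _ _ _ Ho); [lra|].
      destruct (Rle_dec x (t + e)) as [Hxe|Hxe]; [apply Hfirst; lra|].
      destruct (orbit_order _ _ _ _ _ _ _ Ho x) as [Hle _]; [lra|].
      specialize (Hcn x). lra. }
    assert (Hzc : z2 c = z2 t + v2 t * (c - t) - g / 2 * (c - t) ^ 2).
    { apply (left_limit_agree z2
               (fun x => z2 t + v2 t * (x - t) - g / 2 * (x - t) ^ 2) t c).
      - lra.
      - intros x Hx. apply (flight_after g t0 z2 v2 t c Hm Ht Hgap). exact Hx.
      - apply (filterlim_filter_le_1 _ (filter_le_within (F := locally c) _)).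
        apply (motion_continuous _ _ _ _ Hm). lra.
      - apply derivable_is_continuous with (l := v2 t - g * (c - t)).
        auto_derive; [exact I|field]. }
    assert (f c < z2 c) by (apply Habove; [lra|exact Hzc]). lra.
Qed.

(** Going backwards from [t] to the last contact [c], the velocity rises by at most
    [g * D], so the ball would have left the plate at [c] with a velocity below
    [- L], against [contact_velocity]. *)
Lemma descent_without_contact (g : R) (f : R -> R) (t0 : R) (z1 v1 z2 v2 : R -> R) (L D : R) :
  0 < g -> (forall x y, Rabs (f y - f x) <= L * Rabs (y - x)) ->
  (forall t, continuous f t) ->
  restricted_orbit g f t0 z1 v1 z2 v2 ->
  forall t, t0 <= t -> v2 t < - L - g * D ->
  forall s, t0 < s -> t - D < s < t -> f s < z2 s.
Proof.
  intros Hg HL Hc Ho t Ht Hv s Hts Hs.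
  pose proof (orbit_motion2 _ _ _ _ _ _ _ Ho) as Hm.
  assert (Hcv : forall x, t0 <= x -> z2 x = f x -> - L <= v2 x)
    by now apply (contact_velocity g f t0 z1 v1 z2 v2).
  destruct (orbit_order _ _ _ _ _ _ _ Ho s) as [[Hlt|Heq] _]; [lra|exact Hlt|].
  exfalso.
  destruct (last_zero (fun x => z2 x - f x) s t) as [c [Hcs [Hc0 Hcn]]].
  - intros x Hx. apply (clearance_continuous g f t0 z1 v1 z2 v2 Hc Ho). lra.
  - intros H0. specialize (Hcv t Ht). nra.
  - lra.
  - lra.
  - assert (Hgap : forall x, c < x <= t -> free_at g z2 v2 x).
    { intros x Hx. apply (orbit_free2 _ _ _ _ _ _ _ Ho); [lra|].
      destruct (orbit_order _ _ _ _ _ _ _ Ho x) as [Hle _]; [lra|].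
      specialize (Hcn x). lra. }
    assert (Hvc : v2 t = v2 c - g * (t - c))
      by (apply (velocity_through_flight g t0 z2); [exact Hm|lra|lra|exact Hgap]).
    specialize (Hcv c). nra.
Qed.

Lemma bounded_upper_bounded_lower (g : R) (f : R -> R) (T t0 : R) (z1 v1 z2 v2 : R -> R) :
  0 < g -> 0 < T -> periodic T f -> class_C1 f ->
  restricted_orbit g f t0 z1 v1 z2 v2 ->
  bounded_velocity t0 v1 -> bounded_velocity t0 v2.
Proof.
  intros Hg HT Hper HC1 Ho [M HM].
  pose proof (orbit_motion2 _ _ _ _ _ _ _ Ho) as Hm.
  destruct (periodic_C1_lipschitz T f HT Hper HC1) as [L HL].
  assert (Hc : forall t, continuous f t).
  { intros t. apply (ex_derive_continuous (V := R_NormedModule)). apply HC1. }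
  assert (HL0 : 0 <= L).
  { specialize (HL 0 1). pose proof (Rabs_pos (f 1 - f 0)).
    rewrite (Rabs_pos_eq (1 - 0)) in HL; lra. }
  assert (HM0 : 0 <= M).
  { specialize (HM t0 (Rle_refl _)). pose proof (Rabs_pos (v1 t0)). lra. }
  (* A little longer than the longest possible free flight of the upper ball. *)
  pose (D := 2 * M / g + 1).
  assert (HgD : g * D = 2 * M + g) by (unfold D; field; lra).
  assert (HD : 0 < D) by nra.
  pose proof (Rabs_pos (v2 t0)) as HV0.
  exists (Rabs (v2 t0) + L + M + g * D). intros t Ht.
  apply Rabs_le; split; apply Rnot_lt_le; intros Hv.
  - (* A fast fall: go back by the time D, or to the start of the orbit if it
       is nearer; the second case would make v2 t0 larger than itself in size. *)
    pose (a := Rmax t0 (t - D)).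
    assert (Ha0 : t0 <= a) by apply Rmax_l.
    assert (HaD : t - D <= a) by apply Rmax_r.
    assert (Hat : a <= t) by (apply Rmax_lub; lra).
    assert (Hlt : a < t).
    { destruct Hat as [|Hat]; [assumption|exfalso].
      assert (Et : t = t0).
      { revert Hat. unfold a, Rmax. destruct Rle_dec; lra. }
      rewrite Et in Hv. pose proof (Rabs_maj2 (v2 t0)). lra. }
    assert (Hclear : forall s, a < s <= t -> free_at g z2 v2 s).
    { intros s Hs. apply (orbit_free2 _ _ _ _ _ _ _ Ho); [lra|].
      destruct (Req_dec s t) as [->|Hst].
      - destruct (orbit_order _ _ _ _ _ _ _ Ho t Ht) as [[Hl|He] _]; [exact Hl|exfalso].
        pose proof (contact_velocity g f t0 z1 v1 z2 v2 L Hg HL Ho t Ht). lra.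
      - apply (descent_without_contact g f t0 z1 v1 z2 v2 L D Hg HL Hc Ho t Ht); lra. }
    assert (Hva : v2 t = v2 a - g * (t - a))
      by (apply (velocity_through_flight g t0 z2); assumption).
    assert (Hslow : v2 a < - (Rabs (v2 t0) + M)) by nra.
    assert (Ea : a = t - D).
    { unfold a, Rmax in *. destruct (Rle_dec t0 (t - D)); [reflexivity|exfalso].
      pose proof (Rabs_maj2 (v2 t0)). lra. }
    assert (g * (a + (D - 1 / 2) - a) <= 2 * M); [|nra].
    apply (fast_interval_short g f t0 z1 v1 z2 v2 M Ho HM a t Ha0).
    + intros s Hs.
      destruct (flight_after g t0 z2 v2 a t Hm Ha0) with (t := s) as [Hvs _]; [|exact Hs|].
      * intros y Hy. apply Hclear; lra.
      * pose proof (Rabs_maj2 (v2 s)). nra.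
    + assert (2 * M / g = D - 1) by (unfold D; ring).
      assert (0 <= 2 * M / g) by (apply Rdiv_le_0_compat; lra). lra.
  - assert (Hclear : forall s, t < s < t + D -> free_at g z2 v2 s).
    { intros s Hs. apply (orbit_free2 _ _ _ _ _ _ _ Ho); [lra|].
      apply (ascent_without_contact g f t0 z1 v1 z2 v2 L D Hg HL Hc Ho t Ht); lra. }
    assert (g * (t + (D - 1 / 2) - t) <= 2 * M); [|nra].
    apply (fast_interval_short g f t0 z1 v1 z2 v2 M Ho HM t (t + D) Ht).
    + intros s Hs.
      destruct (flight_after g t0 z2 v2 t (t + D) Hm Ht Hclear s Hs) as [Hvs _].
      pose proof (Rle_abs (v2 s)). nra.
    + assert (2 * M / g = D - 1) by (unfold D; ring).
      assert (0 <= 2 * M / g) by (apply Rdiv_le_0_compat; lra). lra.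
Qed.

(** * Chains of parabolic arcs *)

Lemma breaks_growth (d : R) (b : nat -> R) :
  (forall n, b n + d <= b (S n)) -> forall n m, b n + INR m * d <= b (n + m)%nat.
Proof.
  intros Hb n m. induction m as [|m IH].
  - simpl. rewrite Nat.add_0_r. lra.
  - rewrite S_INR, Nat.add_succ_r. specialize (Hb (n + m)%nat). lra.
Qed.

Lemma breaks_increasing (d : R) (b : nat -> R) :
  0 < d -> (forall n, b n + d <= b (S n)) -> forall n m, (n <= m)%nat -> b n <= b m.
Proof.
  intros Hd Hb n m Hnm.
  pose proof (breaks_growth d b Hb n (m - n)) as Hgr.
  replace (n + (m - n))%nat with m in Hgr by lia.
  pose proof (pos_INR (m - n)). nra.
Qed.

Lemma breaks_unbounded (d : R) (b : nat -> R) :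
  0 < d -> (forall n, b n + d <= b (S n)) -> forall t, exists n, t < b n.
Proof.
  intros Hd Hb t.
  destruct (INR_unbounded ((t - b 0%nat) / d)) as [n Hn]. exists n.
  pose proof (breaks_growth d b Hb 0 n) as Hgr. simpl in Hgr.
  apply (Rmult_lt_compat_r d) in Hn; [|exact Hd].
  replace ((t - b 0%nat) / d * d) with (t - b 0%nat) in Hn by (field; lra). lra.
Qed.

Lemma breaks_cover (d : R) (b : nat -> R) :
  0 < d -> (forall n, b n + d <= b (S n)) ->
  forall t, b 0%nat <= t -> exists n, b n <= t < b (S n).
Proof.
  intros Hd Hb t Ht.
  destruct (breaks_unbounded d b Hd Hb t) as [n Hn].
  induction n as [|n IH]; [lra|].
  destruct (Rlt_dec t (b n)) as [Hlt|Hge]; [now apply IH|].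
  exists n. lra.
Qed.

Lemma breaks_disjoint (d : R) (b : nat -> R) :
  0 < d -> (forall n, b n + d <= b (S n)) ->
  forall t n m, b n <= t < b (S n) -> b m <= t < b (S m) -> n = m.
Proof.
  intros Hd Hb t n m Hn Hm.
  destruct (Nat.lt_trichotomy n m) as [H|[H|H]]; [exfalso|exact H|exfalso].
  - pose proof (breaks_increasing d b Hd Hb (S n) m H). lra.
  - pose proof (breaks_increasing d b Hd Hb (S m) n H). lra.
Qed.

(** The [n]-th arc, on [[b n, b (S n)]], is the parabola with apex of height [h n]
    at time [a n]; the apex need not lie in that interval.  The position formula
    holds at both ends, the velocity formula only at the left end: this is the
    convention that [v] is the velocity after a collision. *)
Record flight_chain (g : R) (b a h : nat -> R) (z v : R -> R) : Prop := {
  chain_position : forall n t, b n <= t <= b (S n) -> z t = arc g (a n) (h n) t;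
  chain_velocity : forall n t, b n <= t < b (S n) -> v t = - g * (t - a n)
}.

Lemma flight_chain_exists (g d : R) (b a h : nat -> R) :
  0 < d -> (forall n, b n + d <= b (S n)) ->
  (forall n, arc g (a n) (h n) (b (S n)) = arc g (a (S n)) (h (S n)) (b (S n))) ->
  exists z v, flight_chain g b a h z v.
Proof.
  intros Hd Hb Hmatch.
  destruct (functional_choice (fun t n => b 0%nat <= t -> b n <= t < b (S n)))
    as [N HN].
  { intros t. destruct (Rle_dec (b 0%nat) t) as [Ht|Ht].
    - destruct (breaks_cover d b Hd Hb t Ht) as [n Hn]. now exists n.
    - exists 0%nat. intros; contradiction. }
  assert (HNn : forall n t, b n <= t < b (S n) -> N t = n).
  { intros n t Hn. apply (breaks_disjoint d b Hd Hb t); [apply HN|exact Hn].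
    pose proof (breaks_increasing d b Hd Hb 0 n (Nat.le_0_l n)). lra. }
  exists (fun t => arc g (a (N t)) (h (N t)) t), (fun t => - g * (t - a (N t))).
  split; intros n t Hn.
  - destruct (proj2 Hn) as [Hlt|Heq].
    + rewrite (HNn n) by lra. reflexivity.
    + rewrite (HNn (S n)); [rewrite Heq; symmetry; apply Hmatch|].
      specialize (Hb (S n)). lra.
  - now rewrite (HNn n).
Qed.

Lemma chain_free (g : R) (b a h : nat -> R) (z v : R -> R) :
  flight_chain g b a h z v ->
  forall n t, b n < t < b (S n) -> free_at g z v t.
Proof.
  intros Hch n t Ht. split.
  - rewrite (chain_velocity _ _ _ _ _ _ Hch n) by lra.
    apply (is_derive_ext_loc (arc g (a n) (h n))); [|apply is_derive_arc].
    apply (locally_between _ (b n) t (b (S n)) Ht). intros y Hy.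
    symmetry. apply (chain_position _ _ _ _ _ _ Hch). lra.
  - apply (is_derive_ext_loc (fun y => - g * (y - a n))).
    + apply (locally_between _ (b n) t (b (S n)) Ht). intros y Hy.
      symmetry. apply (chain_velocity _ _ _ _ _ _ Hch). lra.
    + auto_derive; [exact I|ring].
Qed.

Lemma chain_velocity_before (g : R) (b a h : nat -> R) (z v : R -> R) :
  flight_chain g b a h z v ->
  forall n, b n < b (S n) -> velocity_before v (b (S n)) (- g * (b (S n) - a n)).
Proof.
  intros Hch n Hn. unfold velocity_before.
  apply (filterlim_ext_loc (fun y => - g * (y - a n))).
  - apply (at_left_between _ (b n)); [exact Hn|]. intros y Hy.
    symmetry. apply (chain_velocity _ _ _ _ _ _ Hch). lra.
  - apply (filterlim_filter_le_1 _ (filter_le_within (F := locally _) _)).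
    apply (derivable_is_continuous (fun y => - g * (y - a n)) _ (- g)).
    auto_derive; [exact I|ring].
Qed.

Lemma break_or_between (d : R) (b : nat -> R) :
  0 < d -> (forall n, b n + d <= b (S n)) ->
  forall t, b 0%nat < t ->
  (exists n, t = b (S n)) \/ (exists n, b n < t < b (S n)).
Proof.
  intros Hd Hb t Ht.
  destruct (breaks_cover d b Hd Hb t) as [n [[Hn|Hn] Hn']]; [lra| |].
  - right. exists n. lra.
  - left. destruct n as [|n]; [lra|]. now exists n.
Qed.

Lemma flight_chain_motion (g d : R) (b a h : nat -> R) (z v : R -> R) :
  0 < d -> (forall n, b n + d <= b (S n)) ->
  flight_chain g b a h z v -> ball_motion g (b 0%nat) z v.
Proof.
  intros Hd Hb Hch.
  assert (Hcont : forall n t, continuous (arc g (a n) (h n)) t).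
  { intros n t. apply (derivable_is_continuous _ _ _ (is_derive_arc g (a n) (h n) t)). }
  split.
  - specialize (Hb 0%nat).
    rewrite (chain_position _ _ _ _ _ _ Hch 0) by lra.
    apply (filterlim_ext_loc (arc g (a 0%nat) (h 0%nat))).
    + apply (at_right_between _ _ (b 1%nat)); [lra|]. intros y Hy.
      symmetry. apply (chain_position _ _ _ _ _ _ Hch). lra.
    + apply (filterlim_filter_le_1 _ (filter_le_within (F := locally _) _)), Hcont.
  - intros t Ht.
    destruct (break_or_between d b Hd Hb t Ht) as [[n ->]|[n Hn]].
    + pose proof (Hb n) as Hn. pose proof (Hb (S n)) as HSn.
      pose proof (chain_position _ _ _ _ _ _ Hch n) as Hl.
      pose proof (chain_position _ _ _ _ _ _ Hch (S n)) as Hr.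
      apply filterlim_locally. intros eps.
      assert (Hnear : forall m, z (b (S n)) = arc g (a m) (h m) (b (S n)) ->
        locally (b (S n)) (fun y => ball (z (b (S n))) eps (arc g (a m) (h m) y))).
      { intros m Hm. rewrite Hm. apply (proj1 (filterlim_locally _ _) (Hcont m _)). }
      generalize (filter_and (F := locally (b (S n))) _ _ (Hnear n (Hl (b (S n)) ltac:(lra)))
        (filter_and (F := locally (b (S n))) _ _ (Hnear (S n) (Hr (b (S n)) ltac:(lra)))
          (locally_between (fun y => b n < y < b (S (S n))) (b n) (b (S n)) (b (S (S n)))
             ltac:(lra) (fun y Hy => Hy)))).
      apply filter_imp. intros y [H1 [H2 Hy]].
      destruct (Rle_dec y (b (S n))).
      * rewrite (Hl y) by lra. exact H1.
      * rewrite (Hr y) by lra. exact H2.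
    + apply derivable_is_continuous with (l := v t).
      apply (chain_free _ _ _ _ _ _ Hch n t Hn).
  - intros t Ht.
    destruct (breaks_cover d b Hd Hb t Ht) as [n Hn].
    rewrite (chain_velocity _ _ _ _ _ _ Hch n t Hn).
    apply (filterlim_ext_loc (fun y => - g * (y - a n))).
    + apply (at_right_between _ _ (b (S n))); [lra|]. intros y Hy.
      symmetry. apply (chain_velocity _ _ _ _ _ _ Hch). lra.
    + apply (filterlim_filter_le_1 _ (filter_le_within (F := locally _) _)).
      apply (derivable_is_continuous (fun y => - g * (y - a n)) _ (- g)).
      auto_derive; [exact I|ring].
  - intros B. destruct (breaks_unbounded d b Hd Hb B) as [k Hk].
    exists (map b (seq 0 k)). intros t [Ht HtB] Hnot.
    destruct (break_or_between d b Hd Hb t Ht) as [[n ->]|[n Hn]].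
    + apply in_map. apply in_seq. split; [lia|].
      apply Nat.lt_nge. intros Hkn.
      pose proof (breaks_increasing d b Hd Hb k (S n)  Hkn). lra.
    + exfalso. apply Hnot. apply (chain_free _ _ _ _ _ _ Hch n t Hn).
Qed.

(** The hypothesis is the reflection law: the velocities at [b (S n)] are
    [- g * (b (S n) - a n)] before and [- g * (b (S n) - a (S n))] after. *)
Lemma chain_elastic (g : R) (b a h : nat -> R) (z v : R -> R) (n : nat) (u : R) :
  flight_chain g b a h z v -> b n < b (S n) < b (S (S n)) ->
  g * (a n + a (S n)) = 2 * (g * b (S n) + u) ->
  elastic_reflection v (b (S n)) u.
Proof.
  intros Hch Hb Hu. exists (- g * (b (S n) - a n)). split.
  - now apply (chain_velocity_before _ _ _ _ _ _ Hch).
  - rewrite (chain_velocity _ _ _ _ _ _ Hch (S n)) by lra. lra.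
Qed.

(** * The resonant orbit *)

(** The derivative of [f] may be unbounded, so [f] need not be Lipschitz; but from
    the fixed point [t0] the difference quotient is bounded, near [t0] because it
    converges and away from [t0] because [f] is bounded. *)
Lemma growth_from_point (T : R) (f : R -> R) (t0 : R) :
  0 < T -> periodic T f -> (forall t, ex_derive f t) ->
  exists L, 0 < L /\ forall s, Rabs (f (t0 + s) - f t0) <= L * Rabs s.
Proof.
  intros HT Hper Hd.
  destruct (periodic_bounded T f HT Hper) as [M HM].
  { intros t. apply (ex_derive_continuous (V := R_NormedModule)), Hd. }
  pose proof (Derive_correct f t0 (Hd t0)) as Hder.
  apply is_derive_Reals in Hder.
  destruct (Hder 1 Rlt_0_1) as [e He].
  pose proof (cond_pos e) as Hep.
  pose proof (Rabs_pos (Derive f t0)) as Hl.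
  assert (HM0 : 0 <= M) by (specialize (HM t0); pose proof (Rabs_pos (f t0)); lra).
  assert (Hq : 0 <= 2 * M / e) by (apply Rdiv_le_0_compat; lra).
  exists (Rabs (Derive f t0) + 1 + 2 * M / e). split; [lra|].
  intros s. pose proof (Rabs_pos s) as Hs.
  destruct (Req_dec s 0) as [->|Hs0].
  { rewrite Rplus_0_r, Rminus_diag, Rabs_R0. lra. }
  destruct (Rlt_dec (Rabs s) e) as [Hse|Hse].
  - specialize (He s Hs0 Hse).
    replace (f (t0 + s) - f t0)
      with (((f (t0 + s) - f t0) / s - Derive f t0 + Derive f t0) * s) by (field; exact Hs0).
    rewrite Rabs_mult. apply Rmult_le_compat_r; [exact Hs|].
    eapply Rle_trans; [apply Rabs_triang|]. lra.
  - assert (Rabs (f (t0 + s) - f t0) <= 2 * M).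
    { pose proof (HM (t0 + s)) as H1. pose proof (HM t0) as H2.
      apply Rabs_le_between in H1, H2. apply Rabs_le; lra. }
    assert (2 * M <= 2 * M / e * Rabs s).
    { replace (2 * M) with (2 * M / e * e) at 1 by (field; lra).
      apply Rmult_le_compat_l; lra. }
    nra.
Qed.

Lemma unbounded_of_linear_growth (t0 c : R) (v : R -> R) :
  0 < c -> (forall n, exists t, t0 <= t /\ c * INR n <= v t) ->
  unbounded_velocity t0 v.
Proof.
  intros Hc Hgrow [M HM].
  destruct (INR_unbounded (M / c)) as [n Hn].
  destruct (Hgrow n) as [t [Ht Hv]].
  specialize (HM t Ht). pose proof (Rle_abs (v t)).
  apply (Rmult_lt_compat_l c) in Hn; [|exact Hc].
  replace (c * (M / c)) with M in Hn by (field; lra). lra.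
Qed.

(** Bouncing of the lower ball in resonance with the plate: [tau n] are the times of
    contact, all at the height [y], and [len n] the durations of the flights.  A
    flight of duration [len n] starts and ends with speed [g * len n / 2], so a
    plate velocity [g * r / 2] lengthens the next flight by [2 * r].  The right side
    of [resonant_above] is the height of the ball at time [s] of the flight. *)
Record resonant_bouncing (g : R) (f : R -> R) (r y : R) (len tau : nat -> R) : Prop := {
  resonant_increment : 0 < r;
  resonant_first : 2 * r < len 0%nat;
  resonant_longer : forall n, len (S n) = len n + 2 * r;
  resonant_next : forall n, tau (S n) = tau n + len n;
  resonant_height : forall n, f (tau n) = y;
  resonant_speed : forall n, Derive f (tau n) = g * r / 2;
  resonant_above : forall n s, 0 < s < len n ->
    f (tau n + s) < y + g / 2 * s * (len n - s)
}.

(** This is [tau n + len (n - 1) / 2] for positive [n]. *)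
Definition meeting (r : R) (len tau : nat -> R) (n : nat) : R := tau n + len n / 2 - r.

Definition upper_breaks (r : R) (len tau : nat -> R) (n : nat) : R :=
  match n with O => tau O | S k => meeting r len tau k end.

Definition lower_chain (g y : R) (len tau : nat -> R) (z v : R -> R) : Prop :=
  flight_chain g tau (fun n => tau n + len n / 2) (fun n => y + g / 8 * len n ^ 2) z v.

(** The arcs of the upper ball have their apexes at the bounce times of the lower
    ball and change at the meetings; the first arc starts at its apex. *)
Definition upper_chain (g r y : R) (len tau : nat -> R) (z v : R -> R) : Prop :=
  flight_chain g (upper_breaks r len tau) tau
    (fun n => y + g / 4 * len n * (len n - 2 * r)) z v.

Lemma resonant_len (g : R) (f : R -> R) (r y : R) (len tau : nat -> R) :
  resonant_bouncing g f r y len tau ->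
  forall n, len n = len 0%nat + 2 * r * INR n.
Proof.
  intros Hres n. induction n as [|n IH].
  - simpl. ring.
  - rewrite S_INR, (resonant_longer _ _ _ _ _ _ Hres), IH. ring.
Qed.

Lemma resonant_len_ge (g : R) (f : R -> R) (r y : R) (len tau : nat -> R) :
  resonant_bouncing g f r y len tau -> forall n, 2 * r < len 0%nat <= len n.
Proof.
  intros Hres n. split; [exact (resonant_first _ _ _ _ _ _ Hres)|].
  rewrite (resonant_len g f r y len tau Hres n).
  pose proof (pos_INR n). pose proof (resonant_increment _ _ _ _ _ _ Hres). nra.
Qed.

Lemma lower_steps (g : R) (f : R -> R) (r y : R) (len tau : nat -> R) :
  resonant_bouncing g f r y len tau -> forall n, tau n + len 0%nat <= tau (S n).
Proof.
  intros Hres n. rewrite (resonant_next _ _ _ _ _ _ Hres).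
  pose proof (resonant_len_ge g f r y len tau Hres n). lra.
Qed.

Lemma upper_steps (g : R) (f : R -> R) (r y : R) (len tau : nat -> R) :
  resonant_bouncing g f r y len tau ->
  forall n, upper_breaks r len tau n + (len 0%nat / 2 - r) <= upper_breaks r len tau (S n).
Proof.
  intros Hres [|n]; simpl; unfold meeting; [lra|].
  rewrite (resonant_next _ _ _ _ _ _ Hres), (resonant_longer _ _ _ _ _ _ Hres).
  pose proof (resonant_increment _ _ _ _ _ _ Hres).
  pose proof (resonant_len_ge g f r y len tau Hres n). lra.
Qed.

Lemma resonant_chains_exist (g : R) (f : R -> R) (r y : R) (len tau : nat -> R) :
  resonant_bouncing g f r y len tau ->
  exists z1 v1 z2 v2, upper_chain g r y len tau z1 v1 /\ lower_chain g y len tau z2 v2.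
Proof.
  intros Hres.
  pose proof (resonant_increment _ _ _ _ _ _ Hres) as Hr.
  pose proof (resonant_first _ _ _ _ _ _ Hres) as Hl.
  destruct (flight_chain_exists g (len 0%nat / 2 - r) (upper_breaks r len tau) tau
    (fun n => y + g / 4 * len n * (len n - 2 * r))) as [z1 [v1 H1]].
  - lra.
  - apply (upper_steps g f r y len tau Hres).
  - intros n. simpl. unfold arc, meeting.
    rewrite (resonant_next _ _ _ _ _ _ Hres), (resonant_longer _ _ _ _ _ _ Hres). field.
  - destruct (flight_chain_exists g (len 0%nat) tau
      (fun n => tau n + len n / 2) (fun n => y + g / 8 * len n ^ 2)) as [z2 [v2 H2]].
    + lra.
    + apply (lower_steps g f r y len tau Hres).
    + intros n. unfold arc.
      rewrite (resonant_next _ _ _ _ _ _ Hres), (resonant_longer _ _ _ _ _ _ Hres). field.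
    + exists z1, v1, z2, v2. split; assumption.
Qed.

(** In free flight the difference of the positions is affine in time.  The upper
    ball is at rest at [tau n], when the lower one rises at [g * len n / 2]; this is
    the relative speed, and the meeting reverses the relative velocity. *)
Lemma resonant_distance (g : R) (f : R -> R) (r y : R) (len tau : nat -> R)
    (z1 v1 z2 v2 : R -> R) :
  resonant_bouncing g f r y len tau ->
  upper_chain g r y len tau z1 v1 -> lower_chain g y len tau z2 v2 ->
  forall n t, tau n <= t <= tau (S n) ->
    z1 t - z2 t = g * len n / 2 * Rabs (t - meeting r len tau n).
Proof.
  intros Hres H1 H2 n t Ht.
  pose proof (resonant_increment _ _ _ _ _ _ Hres) as Hr.
  pose proof (resonant_next _ _ _ _ _ _ Hres) as Hnext.
  pose proof (resonant_longer _ _ _ _ _ _ Hres) as Hlonger.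
  pose proof (resonant_len_ge g f r y len tau Hres) as Hlen.
  rewrite (chain_position _ _ _ _ _ _ H2 n t Ht).
  pose proof (Hlen n).
  destruct (Rle_dec t (meeting r len tau n)) as [Hle|Hgt].
  - rewrite (chain_position _ _ _ _ _ _ H1 n).
    + rewrite Rabs_left1 by lra. unfold arc, meeting. field.
    + split; [|exact Hle]. destruct n as [|n]; [simpl; lra|].
      simpl. unfold meeting. rewrite Hnext in Ht. specialize (Hlen n). lra.
  - rewrite (chain_position _ _ _ _ _ _ H1 (S n)).
    + rewrite Rabs_pos_eq by lra. unfold arc, meeting. rewrite Hnext, Hlonger. field.
    + simpl. split; [lra|]. unfold meeting at 1. rewrite Hnext, Hlonger in *. lra.
Qed.

Lemma resonant_clearance (g : R) (f : R -> R) (r y : R) (len tau : nat -> R)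
    (z2 v2 : R -> R) :
  resonant_bouncing g f r y len tau -> lower_chain g y len tau z2 v2 ->
  forall n t, tau n < t < tau (S n) -> f t < z2 t.
Proof.
  intros Hres H2 n t Ht.
  rewrite (chain_position _ _ _ _ _ _ H2 n) by lra.
  rewrite (resonant_next _ _ _ _ _ _ Hres) in Ht.
  pose proof (resonant_above _ _ _ _ _ _ Hres n (t - tau n)) as Hab.
  replace (tau n + (t - tau n)) with t in Hab by ring.
  unfold arc.
  replace (y + g / 8 * len n ^ 2 - g / 2 * (t - (tau n + len n / 2)) ^ 2)
    with (y + g / 2 * (t - tau n) * (len n - (t - tau n))) by field.
  apply Hab. lra.
Qed.

Lemma resonant_contact (g : R) (f : R -> R) (r y : R) (len tau : nat -> R)
    (z2 v2 : R -> R) :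
  resonant_bouncing g f r y len tau -> lower_chain g y len tau z2 v2 ->
  forall n, z2 (tau n) = f (tau n).
Proof.
  intros Hres H2 n.
  pose proof (lower_steps g f r y len tau Hres n).
  pose proof (resonant_increment _ _ _ _ _ _ Hres).
  pose proof (resonant_first _ _ _ _ _ _ Hres).
  rewrite (chain_position _ _ _ _ _ _ H2 n) by lra.
  rewrite (resonant_height _ _ _ _ _ _ Hres). unfold arc. field.
Qed.

Lemma resonant_orbit (g : R) (f : R -> R) (r y : R) (len tau : nat -> R)
    (z1 v1 z2 v2 : R -> R) :
  0 < g -> resonant_bouncing g f r y len tau ->
  upper_chain g r y len tau z1 v1 -> lower_chain g y len tau z2 v2 ->
  restricted_orbit g f (tau 0%nat) z1 v1 z2 v2.
Proof.
  intros Hg Hres H1 H2.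
  pose proof (resonant_increment _ _ _ _ _ _ Hres) as Hr.
  pose proof (resonant_first _ _ _ _ _ _ Hres) as Hfirst.
  pose proof (resonant_next _ _ _ _ _ _ Hres) as Hnext.
  pose proof (resonant_longer _ _ _ _ _ _ Hres) as Hlonger.
  pose proof (resonant_len_ge g f r y len tau Hres) as Hlen.
  pose proof (lower_steps g f r y len tau Hres) as Hstep2.
  pose proof (upper_steps g f r y len tau Hres) as Hstep1.
  pose proof (resonant_distance g f r y len tau z1 v1 z2 v2 Hres H1 H2) as Hdist.
  pose proof (resonant_clearance g f r y len tau z2 v2 Hres H2) as Hclear.
  pose proof (resonant_contact g f r y len tau z2 v2 Hres H2) as Hcontact.
  assert (Hd1 : 0 < len 0%nat / 2 - r) by lra.
  assert (Hd2 : 0 < len 0%nat) by lra.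
  assert (Hcover : forall t, tau 0%nat <= t -> exists n, tau n <= t < tau (S n))
    by exact (breaks_cover _ tau Hd2 Hstep2).
  assert (Hmeet : forall n, tau n < meeting r len tau n < tau (S n)).
  { intros n. specialize (Hlen n). rewrite Hnext. unfold meeting. lra. }
  assert (Hplate : forall t, tau 0%nat <= t -> f t <= z2 t).
  { intros t Ht. destruct (Hcover t Ht) as [n [[Hn|<-] Hn']].
    - apply Rlt_le, (Hclear n). lra.
    - rewrite Hcontact. apply Rle_refl. }
  assert (Hballs : forall t, tau 0%nat <= t -> z2 t <= z1 t).
  { intros t Ht. destruct (Hcover t Ht) as [n Hn].
    specialize (Hdist n t). specialize (Hlen n).
    pose proof (Rabs_pos (t - meeting r len tau n)).
    assert (0 <= g * len n / 2 * Rabs (t - meeting r len tau n)); [|lra].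
    apply Rmult_le_pos; nra. }
  assert (Htouch : forall n t, tau n <= t <= tau (S n) -> z1 t = z2 t ->
            t = meeting r len tau n).
  { intros n t Ht Hz. specialize (Hdist n t Ht). specialize (Hlen n).
    destruct (Req_dec (t - meeting r len tau n) 0) as [H0|H0]; [lra|exfalso].
    apply Rabs_pos_lt in H0.
    assert (0 < g * len n / 2 * Rabs (t - meeting r len tau n)); [|lra].
    apply Rmult_lt_0_compat; nra. }
  split.
  - change (tau 0%nat) with (upper_breaks r len tau 0).
    exact (flight_chain_motion _ _ _ _ _ _ _ Hd1 Hstep1 H1).
  - exact (flight_chain_motion _ _ _ _ _ _ _ Hd2 Hstep2 H2).
  - intros t Ht. split; auto.
  - intros t Ht. destruct (Hcover t Ht) as [n [[Hn|Hn] Hn']].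
    + apply Rlt_le_trans with (z2 t); [apply (Hclear n); lra|auto].
    + apply Rle_lt_trans with (z2 t); [auto|].
      destruct (Hballs t Ht) as [Hlt|Heq]; [exact Hlt|exfalso].
      pose proof (Htouch n t ltac:(lra) (eq_sym Heq)). specialize (Hmeet n). lra.
  - intros t Ht Hft.
    destruct (break_or_between _ _ Hd2 Hstep2 t Ht) as [[n ->]|[n Hn]].
    + rewrite Hcontact in Hft. lra.
    + exact (chain_free _ _ _ _ _ _ H2 n t Hn).
  - intros s Hs Hz.
    destruct (break_or_between _ _ Hd2 Hstep2 s Hs) as [[n ->]|[n Hn]].
    + apply (chain_elastic _ _ _ _ _ _ _ _ H2).
      * pose proof (Hstep2 n). pose proof (Hstep2 (S n)). lra.
      * cbv beta. rewrite (resonant_speed _ _ _ _ _ _ Hres), Hlonger, (Hnext n). field.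
    + specialize (Hclear n s Hn). lra.
  - intros t Ht Hlt.
    destruct (break_or_between _ _ Hd1 Hstep1 t) as [[n Hn]|[n Hn]]; [exact Ht| |].
    + exfalso. simpl in Hn.
      specialize (Hdist n t). specialize (Hmeet n). rewrite Hn in *.
      rewrite Rminus_diag, Rabs_R0 in Hdist. lra.
    + exact (chain_free _ _ _ _ _ _ H1 n t Hn).
  - intros s Hs Hz.
    destruct (Hcover s (Rlt_le _ _ Hs)) as [n Hn].
    assert (Es : s = meeting r len tau n) by (apply Htouch; [lra|exact Hz]).
    rewrite (chain_velocity _ _ _ _ _ _ H2 n s Hn), Es.
    apply (chain_elastic _ _ _ _ _ _ n _ H1).
    + pose proof (Hstep1 n). pose proof (Hstep1 (S n)). simpl in *. lra.
    + simpl. unfold meeting. rewrite Hnext. field.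
Qed.

Lemma resonant_unbounded (g : R) (f : R -> R) (r y : R) (len tau : nat -> R)
    (z1 v1 z2 v2 : R -> R) :
  0 < g -> resonant_bouncing g f r y len tau ->
  upper_chain g r y len tau z1 v1 -> lower_chain g y len tau z2 v2 ->
  unbounded_velocity (tau 0%nat) v1 /\ unbounded_velocity (tau 0%nat) v2.
Proof.
  intros Hg Hres H1 H2.
  pose proof (resonant_increment _ _ _ _ _ _ Hres) as Hr.
  pose proof (resonant_first _ _ _ _ _ _ Hres) as Hfirst.
  pose proof (resonant_next _ _ _ _ _ _ Hres) as Hnext.
  pose proof (resonant_len g f r y len tau Hres) as Hlen.
  pose proof (resonant_len_ge g f r y len tau Hres) as Hge.
  pose proof (lower_steps g f r y len tau Hres) as Hstep2.
  pose proof (upper_steps g f r y len tau Hres) as Hstep1.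
  assert (Hstart : forall n, tau 0%nat <= tau n).
  { intros n. apply (breaks_increasing (len 0%nat)); [lra|exact Hstep2|lia]. }
  assert (Hgr : 0 < g * r) by now apply Rmult_lt_0_compat.
  split; apply (unbounded_of_linear_growth _ (g * r) _ Hgr); intros n.
  - exists (meeting r len tau n). split.
    + specialize (Hstart n). specialize (Hge n). unfold meeting. lra.
    + rewrite (chain_velocity _ _ _ _ _ _ H1 (S n)).
      * unfold meeting. rewrite Hnext.
        replace (- g * (tau n + len n / 2 - r - (tau n + len n)))
          with (g * (len n / 2 + r)) by field.
        rewrite Rmult_assoc. apply Rmult_le_compat_l; [lra|].
        specialize (Hlen n). lra.
      * specialize (Hstep1 (S n)). simpl in *. lra.
  - exists (tau n). split; [apply Hstart|].
    rewrite (chain_velocity _ _ _ _ _ _ H2 n).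
    + replace (- g * (tau n - (tau n + len n / 2))) with (g * (len n / 2)) by field.
      rewrite Rmult_assoc. apply Rmult_le_compat_l; [lra|].
      specialize (Hlen n). lra.
    + specialize (Hstep2 n). lra.
Qed.

(** The time of the [n]-th bounce, counted in periods, when the flights last
    [m + 2 * k * p] periods for [p = 0, 1, ...]. *)
Fixpoint bounce_periods (m k n : nat) : nat :=
  match n with
  | O => O
  | S p => bounce_periods m k p + (m + 2 * k * p)
  end.

Lemma resonant_bouncing_exists (g T : R) (f : R -> R) :
  0 < g -> 0 < T -> class_C g T f ->
  exists r y len tau, resonant_bouncing g f r y len tau.
Proof.
  intros Hg HT [Hper [Hd [t0 [K [HK Hspeed]]]]].
  destruct (growth_from_point T f t0 HT Hper Hd) as [L [HL Hgrow]].
  destruct (INR_unbounded (4 * L / (g * T))) as [m0 Hm0].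
  (* The term m0 makes the flights steep enough to clear the plate; the rest
     gives 2 * r < len 0, which places the upper ball above the lower one. *)
  pose (m := (m0 + 2 * K + 1)%nat).
  pose (len := fun n => INR (m + 2 * K * n) * T).
  pose (tau := fun n => t0 + INR (bounce_periods m K n) * T).
  assert (HKpos : 0 < INR K) by now apply lt_0_INR.
  assert (Hm : INR m = INR m0 + 2 * INR K + 1).
  { unfold m. rewrite !plus_INR, mult_INR. simpl. ring. }
  assert (Hlenge : forall n, 4 * L / g < len n).
  { intros n. apply Rlt_le_trans with (INR m * T).
    - replace (4 * L / g) with (4 * L / (g * T) * T) by (field; lra).
      apply Rmult_lt_compat_r; lra.
    - unfold len. rewrite plus_INR. pose proof (pos_INR (2 * K * n)). nra. }
  assert (Hnext : forall n, tau (S n) = tau n + len n).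
  { intros n. unfold tau, len.
    change (bounce_periods m K (S n)) with (bounce_periods m K n + (m + 2 * K * n))%nat.
    rewrite (plus_INR (bounce_periods m K n)). ring. }
  exists (INR K * T), (f t0), len, tau. split.
  - now apply Rmult_lt_0_compat.
  - unfold len. rewrite Nat.mul_0_r, Nat.add_0_r, Hm.
    pose proof (pos_INR m0). nra.
  - intros n. unfold len.
    replace (m + 2 * K * S n)%nat with (m + 2 * K * n + 2 * K)%nat by lia.
    rewrite plus_INR, (mult_INR 2 K). simpl. ring.
  - exact Hnext.
  - intros n. apply (periodic_shift T f Hper).
  - intros n. unfold tau. rewrite (periodic_shift T (Derive f)) by now apply Derive_periodic.
    rewrite Hspeed. field.
  - (* The height above y is at least L times the distance in time to the nearer
       end of the flight, and both ends are at the phase of t0. *)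
    intros n s Hs. specialize (Hlenge n).
    assert (HLg : 4 * L < g * len n).
    { apply (Rmult_lt_compat_l g) in Hlenge; [|exact Hg].
      replace (g * (4 * L / g)) with (4 * L) in Hlenge by (field; lra). exact Hlenge. }
    destruct (Rle_dec s (len n / 2)) as [Hhalf|Hhalf].
    + replace (f (tau n + s)) with (f (t0 + s)).
      * specialize (Hgrow s). rewrite (Rabs_pos_eq s) in Hgrow by lra.
        apply Rabs_le_between in Hgrow.
        assert (0 < s * (g / 2 * (len n - s) - L)); [|nra].
        apply Rmult_lt_0_compat; nra.
      * rewrite <- (periodic_shift T f Hper (bounce_periods m K n) (t0 + s)).
        unfold tau. f_equal. ring.
    + replace (f (tau n + s)) with (f (t0 + (s - len n))).
      * specialize (Hgrow (s - len n)). rewrite (Rabs_left1 (s - len n)) in Hgrow by lra.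
        apply Rabs_le_between in Hgrow.
        assert (0 < (len n - s) * (g / 2 * s - L)); [|nra].
        apply Rmult_lt_0_compat; nra.
      * rewrite <- (periodic_shift T f Hper (bounce_periods m K (S n))).
        fold (tau (S n)). f_equal. specialize (Hnext n). unfold tau in *. lra.
Qed.

Theorem theorem3 :
  forall (g T : R), 0 < g -> 0 < T ->
  forall f : R -> R,
    (periodic T f -> class_C1 f ->
       forall (t0 : R) (z1 v1 z2 v2 : R -> R),
         restricted_orbit g f t0 z1 v1 z2 v2 ->
         ~ (unbounded_velocity t0 v2 /\ bounded_velocity t0 v1))
    /\
    (class_C g T f ->
       exists (t0 : R) (z1 v1 z2 v2 : R -> R),
         restricted_orbit g f t0 z1 v1 z2 v2 /\
         unbounded_velocity t0 v1 /\ unbounded_velocity t0 v2).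
Proof.
  intros g T Hg HT f. split.
  - intros Hper HC1 t0 z1 v1 z2 v2 Ho [Hunb Hbnd].
    apply Hunb. now apply (bounded_upper_bounded_lower g f T t0 z1 v1 z2 v2).
  - intros HC.
    destruct (resonant_bouncing_exists g T f Hg HT HC) as [r [y [len [tau Hres]]]].
    destruct (resonant_chains_exist g f r y len tau Hres)
      as [z1 [v1 [z2 [v2 [H1 H2]]]]].
    exists (tau 0%nat), z1, v1, z2, v2. split.
    + now apply (resonant_orbit g f r y len tau).
    + now apply (resonant_unbounded g f r y len tau z1 v1 z2 v2).
Qed.
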